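(* Let $G$ be a graph with at least one edge. Then $\alpha_{\rm es}(G)=\alpha(G)-1$ if and only if either $G=K_n$ for some $n\geq 2$, or for every $\alpha_{\rm es}(G)$-set $B$ the following two conditions hold: (i) the set $D=V(G)- N[B]$ induces a complete graph, and (ii) for every subset $B'\subseteq B$, $\alpha(G[\mathrm{epn}(B',B)\cup D]) \leq |B'|+1$.
   Context: All graphs are finite and simple; $\alpha(G)$ is the independence number and $G[S]$ is the subgraph of $G$ induced by $S$. For $B\subseteq V(G)$, $N[B]=\bigcup_{b\in B}N[b]$ and $N(B)=N[B]- B$. A set $B\subseteq V(G)$ is an externally supported independence set (ESI-set) if $B$ is independent and every $v\in N(B)$ has a neighbor in $V(G)- N[B]$ (the empty set is an ESI-set). $\alpha_{\rm es}(G)$ is the maximum cardinality of an ESI-set of $G$, and an $\alpha_{\rm es}(G)$-set is an ESI-set of cardinality $\alpha_{\rm es}(G)$. For an ESI-set $B$ and $B'\subseteq B$, the external private neighborhood of $B'$ with respect to $B$ is $\mathrm{epn}(B',B)=N(B')- N(B- B')$, i.e. the set of all vertices adjacent to at least one vertex of $B'$ and to no vertex of $B- B'$. *)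

(* Defs.v *)
From mathcomp Require Import all_boot.

Set Implicit Arguments.
Unset Strict Implicit.
Unset Printing Implicit Defensive.

Record sgraph := SGraph {
  vertex :> finType;
  adj : rel vertex;
  adj_sym : symmetric adj;
  adj_irrefl : irreflexive adj
}.

Definition complete_adj (n : nat) : rel 'I_n := fun i j => i != j.

Lemma complete_adj_sym n : symmetric (@complete_adj n).
Proof. by move=> i j; rewrite /complete_adj eq_sym. Qed.

Lemma complete_adj_irrefl n : irreflexive (@complete_adj n).
Proof. by move=> i; rewrite /complete_adj eqxx. Qed.

Definition complete_graph (n : nat) : sgraph :=
  SGraph (@complete_adj_sym n) (@complete_adj_irrefl n).

Definition isomorphic (G H : sgraph) : Prop :=
  exists2 f : G -> H,
    bijective f & forall x y : G, adj (f x) (f y) = adj x y.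

Definition is_complete (G : sgraph) : Prop :=
  forall x y : G, x != y -> adj x y.

Section Graph.
Variable G : sgraph.
Implicit Types (S B : {set G}) (v : G).

Definition induced_adj S : rel {x : G | x \in S} :=
  fun x y => adj (val x) (val y).

Lemma induced_adj_sym S : symmetric (@induced_adj S).
Proof. by move=> x y; apply: adj_sym. Qed.

Lemma induced_adj_irrefl S : irreflexive (@induced_adj S).
Proof. by move=> x; apply: adj_irrefl. Qed.

Definition induced S : sgraph :=
  SGraph (@induced_adj_sym S) (@induced_adj_irrefl S).

Definition independent S : bool :=
  [forall x in S, forall y in S, ~~ adj x y].

Definition alpha : nat := \max_(S : {set G} | independent S) #|S|.

Definition cl_nbhd v : {set G} := [set w | (w == v) || adj v w].
Definition cl_nbhds B : {set G} := \bigcup_(b in B) cl_nbhd b.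
Definition op_nbhds B : {set G} := cl_nbhds B :\: B.

Definition esi_set B : bool :=
  independent B &&
  [forall v in op_nbhds B, exists w in ~: cl_nbhds B, adj v w].

(* The maximum is attained: set0 is an ESI-set. *)
Definition alpha_es : nat := \max_(B : {set G} | esi_set B) #|B|.

Definition alpha_es_set B : bool := esi_set B && (#|B| == alpha_es).

Definition epn B' B : {set G} := op_nbhds B' :\: op_nbhds (B :\: B').

End Graph.

(* Main.v *)
(** If [B] is an ESI-set of a graph with an edge, then [D = V - N[B]] is nonempty
    (otherwise [N(B)] would be empty and [B = V] independent), so a vertex of [D]
    can be added to [B]; hence [alpha_es G < alpha G] always.  Replacing [B'] in [B]
    by an independent subset of [epn(B', B) U D] leaves an independent set.  If
    [alpha G = alpha_es G + 1], its cardinality bound is (ii), and (i) is the case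
    where [B'] is empty.  Conversely, for a maximum
    independent set [I], the set [I - B] lies in [epn(B - I, B) U D], so (ii) with
    [B' = B - I] gives [#|I| <= #|B| + 1]. *)
Require Import Defs.
From mathcomp Require Import all_boot.

Section Graphs.
Variable G : sgraph.
Implicit Types (S B I : {set G}).

Lemma independentP S :
  reflect {in S &, forall x y, ~~ adj x y} (independent S).
Proof.
apply: (iffP forall_inP) => [h x y xS yS | h x xS].
  by have /forall_inP := h x xS; apply.
by apply/forall_inP => y; apply: h.
Qed.

Lemma independent_card S : independent S -> #|S| <= alpha G.
Proof. by move=> iS; apply: (leq_bigmax_cond (F := fun S : {set G} => #|S|)). Qed.

Lemma independentU S I : independent S -> independent I ->
  {in S & I, forall x y, ~~ adj x y} -> independent (S :|: I).
Proof.
move=> /independentP iS /independentP iI h; apply/independentP => x y.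
rewrite !inE => /orP[xS|xI] /orP[yS|yI]; [exact: iS| exact: h| | exact: iI].
by rewrite adj_sym h.
Qed.

Lemma independent1 x : independent [set x : G].
Proof. by apply/independentP => y z /set1P-> /set1P->; rewrite adj_irrefl. Qed.

Lemma independent_sub S I : S \subset I -> independent I -> independent S.
Proof.
by move=> /subsetP sSI /independentP h; apply/independentP => x y /sSI xI /sSI; apply: h.
Qed.

Lemma mem_cl_nbhds B v :
  (v \in cl_nbhds B) = (v \in B) || [exists b in B, adj b v].
Proof.
apply/bigcupP/orP => [[b bB]|[vB|/exists_inP[b bB bv]]].
- by rewrite inE => /orP[/eqP-> | bv]; [left | right; apply/exists_inP; exists b].
- by exists v; rewrite // inE eqxx.
- by exists b; rewrite // inE bv orbT.
Qed.

Lemma notin_cl_nbhds B v : v \notin cl_nbhds B -> {in B, forall b, ~~ adj b v}.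
Proof.
by rewrite mem_cl_nbhds negb_or negb_exists_in => /andP[_ /forall_inP].
Qed.

(** Since [B] is independent, a neighbour of [B'] cannot lie in [B]; this turns the nested set
    differences of [epn] into plain adjacency conditions. *)
Lemma epnP B' B v : B' \subset B -> independent B ->
  reflect [/\ v \notin B, exists2 b, b \in B' & adj b v &
              {in B :\: B', forall b, ~~ adj b v}]
          (v \in epn B' B).
Proof.
move=> /subsetP sB /independentP iB; rewrite /epn /op_nbhds !in_setD !mem_cl_nbhds.
apply: (iffP idP).
- case/andP=> h /andP[vB']; rewrite (negPf vB') /= => /exists_inP[b bB' bv].
  have vB : v \notin B by apply: contraL bv => vB; apply: iB => //; apply: sB.
  split=> //; first by exists b.
  by apply/forall_inP; move: h; rewrite !in_setD (negPf vB) andbF /= negb_exists_in.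
- case=> vB [b bB' bv] /forall_inP h; rewrite (contraNN (@sB v) vB) /= in_setD.
  rewrite (negPf vB) andbF /= -negb_exists_in in h *; rewrite h /=.
  by apply/orP; right; apply/exists_inP; exists b.
Qed.

(** Independent sets of [induced S] and independent subsets of [S] correspond through [val], so
    later arguments can stay inside [G]. *)
Lemma alpha_induced_leP S k :
  alpha (induced S) <= k <->
  (forall I, I \subset S -> independent I -> #|I| <= k).
Proof.
split=> [le_k I sIS iI | h].
- apply: leq_trans le_k; pose J : {set induced S} := [set x | val x \in I].
  have -> : #|I| = #|J|.
    rewrite -(card_imset _ val_inj); apply: eq_card => x.
    apply/idP/imsetP => [xI|[y]]; last by rewrite inE => ? ->.
    by exists (Sub x (subsetP sIS x xI)); rewrite ?inE.
  apply: (leq_bigmax_cond (F := fun J : {set induced S} => #|J|)).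
  apply/forall_inP => x; rewrite inE => xI; apply/forall_inP => y; rewrite inE => yI.
  by move/independentP: iI; apply.
- apply/bigmax_leqP => J /forall_inP iJ; rewrite -(card_imset _ val_inj); apply: h.
    by apply/subsetP => _ /imsetP[x _ ->]; apply: valP.
  apply/independentP => _ _ /imsetP[x xJ ->] /imsetP[y yJ ->].
  by have /forall_inP/(_ y yJ) := iJ x xJ.
Qed.

Lemma esi_set0 : esi_set (set0 : {set G}).
Proof.
rewrite /esi_set /op_nbhds /cl_nbhds big_set0 set0D; apply/andP; split.
  by apply/independentP => x y; rewrite inE.
by apply/forall_inP => v; rewrite inE.
Qed.

Lemma alpha_es_set_exists : exists B, alpha_es_set B.
Proof.
have ex : 0 < #|@esi_set G| by apply/card_gt0P; exists set0; apply: esi_set0.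
have [B esB eqB] := eq_bigmax_cond (fun B : {set G} => #|B|) ex.
by exists B; apply/andP; split; last by rewrite -eqB.
Qed.

Lemma esi_set_card_lt B : (exists x y : G, adj x y) -> esi_set B -> #|B| < alpha G.
Proof.
move=> [x [y xy]] /andP[iB /forall_inP esB].
(* An edge [xy] yields [w]: an endpoint outside [N[B]] serves itself, an endpoint in [N(B)] has an
   external neighbour, and both endpoints cannot lie in the independent set [B]. *)
have [w wD] : exists w, w \notin cl_nbhds B.
  have [xB|?] := boolP (x \in cl_nbhds B); last by exists x.
  have [yB|?] := boolP (y \in cl_nbhds B); last by exists y.
  have supp v : v \in cl_nbhds B -> v \notin B -> exists w, w \notin cl_nbhds B.
    move=> vN vB; have /esB/exists_inP[w] : v \in op_nbhds B by rewrite in_setD vB.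
    by rewrite inE; exists w.
  have [xB'|?] := boolP (x \in B); last exact: (supp x).
  have [yB'|?] := boolP (y \in B); last exact: (supp y).
  by have := independentP _ iB x y xB' yB'; rewrite xy.
have wB : w \notin B by apply: contraNN wD => wB; rewrite mem_cl_nbhds wB.
have <- : #|B :|: [set w]| = #|B|.+1 by rewrite setUC cardsU1 wB.
apply/independent_card/independentU => //; first exact: independent1.
by move=> b _ bB /set1P->; apply: (notin_cl_nbhds _ _ wD).
Qed.

Lemma alpha_es_lt_alpha : (exists x y : G, adj x y) -> alpha_es G < alpha G.
Proof.
by move=> e; have [B /andP[esB /eqP<-]] := alpha_es_set_exists; apply: esi_set_card_lt.
Qed.

(** The bound is the size of the disjoint union of [B :\: B'] and [I], written additively to avoid
    truncated subtraction. *)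
Lemma independent_exchange B B' I : independent B -> B' \subset B ->
  I \subset epn B' B :|: ~: cl_nbhds B -> independent I ->
  #|I| + #|B| <= alpha G + #|B'|.
Proof.
move=> iB sB' /subsetP sI iI.
have sep v : v \in I -> v \notin B /\ {in B :\: B', forall b, ~~ adj b v}.
  move=> /sI; rewrite in_setU in_setC => /orP[/epnP[]// | vD]; split.
    by apply: contraNN vD => vB; rewrite mem_cl_nbhds vB.
  by move=> b /setDP[bB _]; apply: (notin_cl_nbhds _ _ vD).
have disj : (B :\: B') :&: I = set0.
  apply/setP=> v; rewrite !inE; apply/negP => /andP[/andP[_ vB] /sep[]].
  by rewrite vB.
have : #|(B :\: B') :|: I| <= alpha G.
  apply/independent_card/independentU => //.
    exact: independent_sub _ _ (subsetDl _ _) iB.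
  by move=> b v bB /sep[_]; apply.
rewrite cardsU disj cards0 subn0 cardsD (setIidPr sB') => le_alpha.
rewrite -(subnK (subset_leq_card sB')) addnA [#|I| + _]addnC.
by rewrite leq_add2r.
Qed.

Lemma alpha_le_epn B : independent B ->
  (forall B', B' \subset B ->
     alpha (induced (epn B' B :|: ~: cl_nbhds B)) <= #|B'| + 1) ->
  alpha G <= #|B|.+1.
Proof.
move=> iB h; apply/bigmax_leqP => I iI.
have sBI : B :\: I \subset B by apply: subsetDl.
have /alpha_induced_leP/(_ (I :\: B)) le_diff := h _ sBI.
(* Cancelling the common part [B :&: I] leaves [#|I :\: B| <= #|B :\: I| + 1]. *)
rewrite -(cardsID B I) -(cardsID I B) [I :&: B]setIC -addnS leq_add2l -addn1.
apply: le_diff; last exact: independent_sub _ _ (subsetDl _ _) iI.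
apply/subsetP => v /setDP[vI vB]; rewrite in_setU in_setC.
(* If [v] is in [N[B]], it has a neighbour [b] in [B]. As [v] is in [I], [b] is not, so [b] lies in
   [B :\: I]; the remaining vertices of [B] lie in [I] and so are not adjacent to [v]. *)
rewrite orbC -implybE; apply/implyP.
rewrite mem_cl_nbhds (negPf vB) => /exists_inP[b bB bv].
apply/epnP => //; split=> //.
  exists b => //; rewrite in_setD bB andbT.
  by apply: contraL bv => bI; apply: (independentP _ iI).
move=> c; rewrite !in_setD => /andP[]; rewrite negb_and negbK => /orP[cI|/negPf->//] _.
exact: (independentP _ iI).
Qed.

Lemma complete_alpha_le1 n : isomorphic G (complete_graph n) -> alpha G <= 1.
Proof.
case=> f /bij_inj injf adjf; apply/bigmax_leqP => I /independentP iI.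
apply/card_le1_eqP => x y xI yI; apply: injf; apply/eqP/negbNE.
by have := iI y x yI xI; rewrite -adjf.
Qed.

(** Two nonadjacent vertices of [D] could both join [B]: exchanging [set0] for the pair would give
    [#|B| + 2 <= alpha G]. *)
Lemma alpha_es_set_complete B : alpha_es_set B -> alpha G = (alpha_es G).+1 ->
  is_complete (induced (~: cl_nbhds B)).
Proof.
move=> /andP[/andP[iB _] /eqP cardB] eq_alpha x y neq_xy.
apply: contraT => nxy.
have iI : independent [set val x; val y].
  apply: independentU; [exact: independent1 | exact: independent1 |].
  by move=> _ _ /set1P-> /set1P->.
have := independent_exchange B set0 _ iB (sub0set _) _ iI.
rewrite cards0 cards2 (inj_eq val_inj) neq_xy cardB eq_alpha addn0 ltnn; apply.
apply: subset_trans (subsetUr _ _); rewrite subUset !sub1set.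
by rewrite (valP x) (valP y).
Qed.

End Graphs.

Theorem proposition12 (G : sgraph) (has_edge : exists x y : G, adj x y) :
  alpha_es G = alpha G - 1 <->
  (exists n : nat, 2 <= n /\ isomorphic G (complete_graph n)) \/
  (forall B : {set G}, alpha_es_set B ->
     is_complete (induced (~: cl_nbhds B)) /\
     (forall B' : {set G}, B' \subset B ->
        alpha (induced (epn B' B :|: ~: cl_nbhds B)) <= #|B'| + 1)).
Proof.
have lt_alpha := alpha_es_lt_alpha G has_edge.
split=> [eq_alpha | h].
(* The strict inequality makes [alpha G] positive, so the subtraction is not truncated. *)
- have {}eq_alpha : alpha G = (alpha_es G).+1.
    by rewrite eq_alpha subn1 prednK // (leq_ltn_trans _ lt_alpha).
  right=> B esB; split; first exact: alpha_es_set_complete.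
  move=> B' sB'; apply/alpha_induced_leP => I sI iI.
  have /andP[/andP[iB _] /eqP cardB] := esB.
  have := independent_exchange G B B' I iB sB' sI iI.
  by rewrite eq_alpha cardB addSnnS addnC leq_add2l addn1.
- suff le_alpha : alpha G <= (alpha_es G).+1.
    have -> : alpha G = (alpha_es G).+1 by apply/eqP; rewrite eqn_leq le_alpha.
    by rewrite subn1.
  (* For a complete graph, [alpha G <= 1] is already below any successor. *)
  case: h => [[n [_ /complete_alpha_le1 le1]] | h]; first exact: leq_trans le1 _.
  have [B esB] := alpha_es_set_exists G; have [_ hB] := h B esB.
  have /andP[/andP[iB _] /eqP <-] := esB.
  exact: alpha_le_epn hB.
Qed.
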